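(* Let $(U,\|\cdot\|_U)$, $(Z,\|\cdot\|_Z)$ be Banach spaces, let $N,d\in\mathbb N$, let $\Xi=\{\xi_i\}_{i=1}^N$ with $\xi_i\in\mathbb R^d$, $\mathcal A=2^\Xi$, and let $$\Delta=\Big\{q\in\mathbb R^N:\ \sum_{i=1}^N q_i=1,\ 0\le q_i\le 1 \text{ for } 1\le i\le N\Big\}.$$ Let $p\in\Delta$ and let $\mathbb P$ be the probability measure on $(\Xi,\mathcal A)$ with $\mathbb P[\xi=\xi_i]=p_i$ for each $i$. Let $f_0: Z\to\overline{\mathbb R}$, $s:\Xi\times Z\to U$, $g:U\to\overline{\mathbb R}$ satisfy Assumptions (S) and (FG) of the context. Fix $1\le q\le\infty$ and let $(p_\epsilon)_{\epsilon>0}\subset\Delta$ be probability vectors that converge to $p$ in the $l^q$ norm $\|\cdot\|_q$ on $\mathbb R^N$ as $\epsilon\downarrow0$. Let $(\theta_\epsilon)_{\epsilon>0}\subset(0,\infty)$ with $\theta_\epsilon\to\infty$ as $\epsilon\downarrow0$. If $q\in[1,\infty)$, assume $$\lim_{\epsilon\downarrow0}\theta_\epsilon\|p_\epsilon-p\|_q^q=0,$$ and if $q=\infty$, assume $$\lim_{\epsilon\downarrow0}\theta_\epsilon\|p_\epsilon-p\|_\infty=0.$$ Define $\Phi,\Phi_\epsilon:Z\times\mathbb R^N\to\overline{\mathbb R}$ by $$\Phi(z,t)=f_0(z)+\sum_{i=1}^N(p_i+t_i)\,g(s(\xi_i,z))+\iota_{\{0\}}(t),$$ $$\Phi_\epsilon(z,t)=f_0(z)+\sum_{i=1}^N(p_{\epsilon,i}+t_i)\,g(s(\xi_i,z))+\frac{\theta_\epsilon}{q}\|t\|_q^q+\iota_\Delta(p_\epsilon+t),$$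 where for $q=\infty$ the term $\frac1q\|t\|_q^q$ is replaced by $\|t\|_\infty$. Then $\Phi_\epsilon$ Mosco converges to $\Phi$ on $Z\times\mathbb R^N$ as $\epsilon\downarrow0$.
   Context: $\overline{\mathbb R}=\mathbb R\cup\{-\infty,\infty\}$. Arrows $\to$ and $\rightharpoonup$ denote strong (norm) and weak convergence. ''Sequences'' are families indexed by $\epsilon>0$, with limits as $\epsilon\downarrow0$. $p_{\epsilon,i}$ is the $i$-th component of $p_\epsilon$. Indicator of a set $S$: $\iota_S(y)=0$ if $y\in S$ and $\infty$ otherwise. Conventions for extended-real values: $\Phi(z,t)=\infty$ whenever $t\ne0$, $\Phi_\epsilon(z,t)=\infty$ whenever $p_\epsilon+t\notin\Delta$, and $0\cdot\infty=0$ in the sums (as for expectations). Assumption (S): (1) $s(\cdot,z):\Xi\to U$ is $\mathcal A$-measurable for all $z\in Z$. (2) If $z_\epsilon\rightharpoonup z$ in $Z$ as $\epsilon\downarrow0$, then $s(\xi,z_\epsilon)\rightharpoonup s(\xi,z)$ in $U$ for $\mathbb P$-almost every $\xi\in\Xi$. Assumption (FG): (1) $f_0$ is proper: $f_0(z)>-\infty$ for all $z\in Z$ and $f_0(z)<\infty$ for some $z\in Z$. (2) $f_0$ and $g$ are weakly sequentially lower semicontinuous: $z_\epsilon\rightharpoonup z$ in $Z$ implies $\liminf_{\epsilon\downarrow0}f_0(z_\epsilon)\ge f_0(z)$, and $u_\epsilon\rightharpoonup u$ in $U$ implies $\liminf_{\epsilon\downarrow0}g(u_\epsilon)\ge g(u)$.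 (3) There exists $\gamma\in\mathbb R$ such that $g(u)\ge\gamma$ for all $u\in U$. Mosco convergence: for a Banach space $X$ and maps $h,h_\epsilon:X\to\overline{\mathbb R}$ ($\epsilon>0$), $h_\epsilon$ Mosco converges to $h$ as $\epsilon\downarrow0$ if (i) for every $x\in X$ there exists $(x_\epsilon)_{\epsilon>0}$ with $x_\epsilon\to x$ (strongly) and $\limsup_{\epsilon\downarrow0}h_\epsilon(x_\epsilon)\le h(x)$; and (ii) for all $(x_\epsilon)_{\epsilon>0}$ with $x_\epsilon\rightharpoonup x$ (weakly), $\liminf_{\epsilon\downarrow0}h_\epsilon(x_\epsilon)\ge h(x)$. Here $X=Z\times\mathbb R^N$ with a product norm. *)

(* Defs.v *)
From HB Require Import structures.
From mathcomp Require Import all_boot all_order all_algebra.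
From mathcomp Require Import all_classical all_reals all_analysis.

Set Implicit Arguments.
Unset Strict Implicit.
Unset Printing Implicit Defensive.

Import Order.TTheory GRing.Theory Num.Theory.
Import numFieldNormedType.Exports.

Local Open Scope classical_set_scope.
Local Open Scope ring_scope.

(* Families indexed by eps > 0 are total functions on R: all limits below are
   taken along the filter 0^'+, which ignores the values at eps <= 0. *)

Definition weak_cvg (R : realType) (X : normedModType R) (x_ : R -> X) (x : X) :
    Prop :=
  forall phi : {linear X -> R^o}, continuous phi ->
    phi (x_ e) @[e --> 0^'+] --> phi x.

Definition weakly_seq_lsc (R : realType) (X : normedModType R)
    (h : X -> \bar R) : Prop :=
  forall (x_ : R -> X) (x : X), weak_cvg x_ x ->
    (h x <= limf_einf (fun e : R => h (x_ e)) 0^'+)%E.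

(* Completeness of X plays no role in the definition. *)
Definition Mosco_cvg (R : realType) (X : normedModType R)
    (h_ : R -> X -> \bar R) (h : X -> \bar R) : Prop :=
  (forall x : X, exists x_ : R -> X,
      x_ e @[e --> 0^'+] --> x /\
      (limf_esup (fun e : R => h_ e (x_ e)) 0^'+ <= h x)%E) /\
  (forall (x_ : R -> X) (x : X), weak_cvg x_ x ->
      (h x <= limf_einf (fun e : R => h_ e (x_ e)) 0^'+)%E).

Section scenario_space.
Context {R : realType} {d n : nat}.

(* The finite set {xi_0, ..., xi_n} of points of R^d, as a type carrying the
   sigma-algebra of all its subsets. *)
Definition scenario_space (xi : 'I_n.+1 -> 'rV[R]_d) : Type :=
  set_type (range xi).

Definition scenario (xi : 'I_n.+1 -> 'rV[R]_d) (i : 'I_n.+1) :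
    scenario_space xi :=
  exist _ (xi i) (mem_set (imageT xi i)).

Variable xi : 'I_n.+1 -> 'rV[R]_d.

HB.instance Definition _ := Choice.on (scenario_space xi).
HB.instance Definition _ := isPointed.Build (scenario_space xi)
  (scenario xi ord0).
HB.instance Definition _ := @isMeasurable.Build default_measure_display
  (scenario_space xi) discrete_measurable discrete_measurable0
  discrete_measurableC discrete_measurableU.

End scenario_space.

(* U carries its Borel sigma-algebra. *)
Definition assumption_S (R : realType) (d n : nat) (xi : 'I_n.+1 -> 'rV[R]_d)
    (P : probability (scenario_space xi) R) (Z U : completeNormedModType R)
    (s : scenario_space xi -> Z -> U) : Prop :=
  (forall z : Z,
      measurable_fun [set: scenario_space xi]
        ((fun x => s x z) : scenario_space xi -> g_sigma_algebraType (@open U)))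
  /\
  (forall (z_ : R -> Z) (z : Z), weak_cvg z_ z ->
      {ae P, forall x, weak_cvg (fun e => s x (z_ e)) (s x z)}).

Definition assumption_FG (R : realType) (Z U : completeNormedModType R)
    (f0 : Z -> \bar R) (g : U -> \bar R) : Prop :=
  [/\ (forall z, (-oo < f0 z)%E) /\ (exists z, (f0 z < +oo)%E),
      weakly_seq_lsc f0,
      weakly_seq_lsc g &
      exists gamma : R, forall u, (gamma%:E <= g u)%E].

Definition prob_simplex {R : realType} {N : nat} : set 'rV[R]_N :=
  [set q | \sum_(i < N) q 0 i = 1 /\ forall i, 0 <= q 0 i <= 1].

(* The l^q norm on R^N for 1 <= q <= +oo; the value at q = -oo is junk. *)
Definition lq_norm {R : realType} {N : nat} (q : \bar R) (t : 'rV[R]_N) : R :=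
  match q with
  | r%:E => (\sum_(i < N) `|t 0 i| `^ r) `^ r^-1
  | +oo%E => \big[Num.max/0]_(i < N) `|t 0 i|
  | -oo%E => 0
  end.

(* (1/q) ||t||_q^q for finite q, and ||t||_oo for q = +oo. *)
Definition lq_penalty {R : realType} {N : nat} (q : \bar R) (t : 'rV[R]_N) : R :=
  match q with
  | r%:E => r^-1 * lq_norm q t `^ r
  | _ => lq_norm q t
  end.

Definition set_indicator {R : realType} {T : Type} (S : set T) (y : T) :
    \bar R :=
  if y \in S then 0%E else +oo%E.

(* In Phi and Phi_eps the indicator is added with dual_adde, for which
   -oo + +oo = +oo: the value is +oo wherever the indicator is, even if a
   negative coefficient makes the sum -oo.  Products are mule, with 0 * oo = 0. *)
Definition Phi {R : realType} {d n : nat} {Z U : completeNormedModType R}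
    (xi : 'I_n.+1 -> 'rV[R]_d) (f0 : Z -> \bar R)
    (s : scenario_space xi -> Z -> U) (g : U -> \bar R) (p : 'rV[R]_n.+1)
    (zt : Z * 'rV[R]_n.+1) : \bar R :=
  let: (z, t) := zt in
  dual_adde
    (f0 z + \sum_(i < n.+1) (p 0 i + t 0 i)%:E * g (s (scenario xi i) z))%E
    (set_indicator [set 0] t).

Definition Phi_eps {R : realType} {d n : nat} {Z U : completeNormedModType R}
    (xi : 'I_n.+1 -> 'rV[R]_d) (f0 : Z -> \bar R)
    (s : scenario_space xi -> Z -> U) (g : U -> \bar R) (q : \bar R)
    (p_ : R -> 'rV[R]_n.+1) (theta : R -> R) (e : R)
    (zt : Z * 'rV[R]_n.+1) : \bar R :=
  let: (z, t) := zt in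
  dual_adde
    (f0 z + \sum_(i < n.+1) (p_ e 0 i + t 0 i)%:E * g (s (scenario xi i) z)
     + (theta e * lq_penalty q t)%:E)%E
    (set_indicator prob_simplex (p_ e + t)).

(* Main.v *)
Require Import Defs.
From HB Require Import structures.
From mathcomp Require Import all_boot all_order all_algebra.
From mathcomp Require Import all_classical all_reals all_analysis.
From mathcomp Require Import ring lra.

Import Order.TTheory GRing.Theory Num.Theory.
Import numFieldNormedType.Exports.

Local Open Scope classical_set_scope.
Local Open Scope ring_scope.

(** The recovery sequence at [(z, 0)] is [(z, p - p_e)]: it moves the weights back
    to [p], and the rate condition kills its penalty.  For the lower bound, where
    [t <> 0] the penalty is at least a constant times [theta_e] and everything
    else is bounded below on the simplex.  Where [t = 0] the penalty is dropped
    and the inequality is proved term by term: a scenario with [p_i > 0] is an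
    atom, so [s] converges weakly there and lower semicontinuity of [g] applies;
    a scenario with [p_i = 0] contributes [0] in the limit, and only the lower
    bound of [g] is needed. *)

(** * Asymptotic lower bounds *)

(* [a <= liminf f] along F.  F need not be proper: it will be [within D 0^'+],
   where D may be avoided by all small parameters. *)
Definition ev_lbound {R : realType} {T : Type} (F : set_system T)
    (f : T -> \bar R) (a : \bar R) : Prop :=
  forall M : R, (M%:E < a)%E -> \forall x \near F, (M%:E <= f x)%E.

Lemma fin_lte_dense (R : realType) (r : R) (b : \bar R) :
  (r%:E < b)%E -> exists2 m : R, r < m & (m%:E < b)%E.
Proof.
case: b => [s| |] //; last by move=> _; exists (r + 1); rewrite ?ltrDl ?ltry.
rewrite lte_fin => /midf_lt[rm ms].
by exists ((r + s) / 2) => //; rewrite lte_fin.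
Qed.

Lemma gtNyD (R : realType) (x y : \bar R) :
  (-oo < x)%E -> (-oo < y)%E -> (-oo < x + y)%E.
Proof. by case: x y => [x| |] [y| |] // _ _; rewrite -EFinD ltNyr. Qed.

Lemma gtNy_sum (R : realType) (I : Type) (r : seq I) (a_ : I -> \bar R) :
  (forall i, (-oo < a_ i)%E) -> (-oo < \sum_(i <- r) a_ i)%E.
Proof.
by move=> aNy; elim/big_ind : _ => //; exact: gtNyD.
Qed.

Section ev_lbound_theory.
Context {R : realType} {T : Type} (F : set_system T) {FF : Filter F}.
Implicit Types (f g : T -> \bar R) (a b : \bar R).

Lemma ev_lbound_le f g a : (\forall x \near F, (f x <= g x)%E) ->
  ev_lbound F f a -> ev_lbound F g a.
Proof.
move=> fg fa M /fa Mf; near=> x.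
by apply: (@le_trans _ _ (f x)); near: x.
Unshelve. all: by end_near. Qed.

Lemma ev_lbound_cst a : ev_lbound F (fun=> a) a.
Proof. by move=> M /ltW Ma; near=> x. Unshelve. all: by end_near. Qed.

Lemma ev_lbound_within (D : set T) f a :
  ev_lbound F f a -> ev_lbound (within D F) f a.
Proof. by move=> fa M /fa; apply: cvg_within. Qed.

(** Excluding [-oo] rules out the sum of opposite infinities. A real [M] below [a + b] is then
    dominated by a sum of reals lying strictly below [a] and [b]. *)
Lemma ev_lboundD f g a b : (-oo < a)%E -> (-oo < b)%E ->
  ev_lbound F f a -> ev_lbound F g b ->
  ev_lbound F (fun x => f x + g x)%E (a + b)%E.
Proof.
move=> aNy bNy fa gb M Mab.
have [m1 [m2 [m1a m2b Mm]]] : exists m1 m2 : R,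
    [/\ (m1%:E < a)%E, (m2%:E < b)%E & M <= m1 + m2].
  (* Two finite bounds each give up half of the slack [r + s - M]; an infinite bound absorbs
     whatever the other leaves. *)
  case: a aNy Mab {fa} => [r| |] // _; case: b bNy {gb} => [s| |] // _.
  - rewrite -EFinD lte_fin => Mrs.
    exists (r - (r + s - M) / 2), (s - (r + s - M) / 2).
    by rewrite !lte_fin; split; lra.
  - by exists (r - 1), (M - r + 1); rewrite lte_fin ltry; split => //; lra.
  - by exists (M - s + 1), (s - 1); rewrite lte_fin ltry; split => //; lra.
  - by exists M, 0; rewrite !ltry addr0.
have Hf := fa _ m1a; have Hg := gb _ m2b.
near=> x; apply: (@le_trans _ _ (m1%:E + m2%:E)%E).
  by rewrite -EFinD lee_fin.
by apply: leeD; near: x.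
Unshelve. all: by end_near. Qed.

Lemma ev_lbound_sum (I : Type) (r : seq I) (f_ : I -> T -> \bar R)
    (a_ : I -> \bar R) :
  (forall i, (-oo < a_ i)%E) -> (forall i, ev_lbound F (f_ i) (a_ i)) ->
  ev_lbound F (fun x => \sum_(i <- r) f_ i x)%E (\sum_(i <- r) a_ i)%E.
Proof.
move=> aNy fa; elim: r => [|i r IH].
  by under eq_fun do rewrite big_nil; rewrite big_nil; exact: ev_lbound_cst.
under eq_fun do rewrite big_cons; rewrite big_cons.
apply: ev_lboundD => //.
exact: gtNy_sum.
Qed.

(* No information on h is needed where the weight vanishes in the limit, beyond
   the uniform lower bound gamma. *)
Lemma ev_lboundM (c_ : T -> R) (c gamma : R) (h : T -> \bar R) b :
  0 <= c -> (\forall x \near F, 0 <= c_ x) -> c_ x @[x --> F] --> c ->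
  (forall x, (gamma%:E <= h x)%E) -> (0 < c -> ev_lbound F h b) ->
  ev_lbound F (fun x => (c_ x)%:E * h x)%E (c%:E * b)%E.
Proof.
move=> c0 c_0 c_c gammah hb M.
have cvgM (m : R) : M < c * m -> \forall x \near F, M <= c_ x * m.
  move=> Mcm; suff : c_ x * m @[x --> F] --> c * m by move/cvgr_ge; exact.
  by apply: cvgM => //; exact: cvg_cst.
move: c0; rewrite le_eqVlt => /predU1P[c0|c0].
  (* The limit bound is [0], whatever [b] is, and [c_ x * gamma] tends to [0 > M]. *)
  rewrite -c0 mul0e lte_fin => M0.
  have H := cvgM gamma; rewrite -c0 mul0r in H; have {}H := H M0.
  near=> x; apply: (@le_trans _ _ ((c_ x)%:E * gamma%:E)%E).
    by rewrite -EFinM lee_fin; near: x.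
  by apply: lee_wpmul2l => //; rewrite lee_fin; near: x.
(* A real [m] strictly between [M / c] and [b] leaves room for replacing [c] by [c_ x]. *)
rewrite -lte_pdivrMl// -EFinM => /fin_lte_dense[m Mm mb].
have H : \forall x \near F, M <= c_ x * m.
  by apply: cvgM; rewrite -ltr_pdivrMl.
have H' := hb c0 _ mb.
near=> x; apply: (@le_trans _ _ ((c_ x)%:E * m%:E)%E).
  by rewrite -EFinM lee_fin; near: x.
by apply: lee_wpmul2l; [rewrite lee_fin; near: x|near: x].
Unshelve. all: by end_near. Qed.

End ev_lbound_theory.

(** The lower limit is the supremum over [V] in [F] of the infimum of [f] on [V]; for a level [M],
    the superlevel set of [f] serves as [V]. *)
Lemma le_limf_einfP (R : realType) (F : set_system R) {FF : Filter F}
    (f : R -> \bar R) (a : \bar R) :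
  (a <= limf_einf f F)%E <-> ev_lbound F f a.
Proof.
rewrite limf_einfE; split=> [ainf M Ma|fa].
  have /ereal_sup_gt[_ [V FV <-] MV] := lt_le_trans Ma ainf.
  apply: filterS FV => x Vx; apply: le_trans (ltW MV) _.
  by apply: ereal_inf_lbound; exists x.
have H (M : R) : (M%:E < a)%E ->
    (M%:E <= ereal_sup [set ereal_inf (f @` V) | V in F])%E.
  move=> Ma; apply: le_ereal_sup_tmp.
  exists (ereal_inf (f @` [set x | (M%:E <= f x)%E])).
    by exists [set x | (M%:E <= f x)%E] => //; exact: fa.
  by apply: le_ereal_inf_tmp => _ [x /= Mfx <-].
case: a H {fa} => [r| |] H; last by rewrite leNye.
- apply/lee_subgt0Pr => e e0; rewrite -EFinB; apply: H.
  by rewrite lte_fin ltrBlDr ltrDl.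
- by rewrite leye_eq; apply/eqP/eqyP => A _; apply: H; rewrite ltry.
Qed.

(** Suited to recovery families, whose values exceed the target by a vanishing penalty [c_]. *)
Lemma limf_esup_le_cvg (R : realType) (F : set_system R) {FF : Filter F}
    (f : R -> \bar R) (a : \bar R) (c_ : R -> R) :
  (\forall x \near F, (f x <= a + (c_ x)%:E)%E) -> c_ x @[x --> F] --> (0 : R) ->
  (limf_esup f F <= a)%E.
Proof.
move=> fac c0; rewrite limf_esupE; apply/lee_addgt0Pr => e e0.
have {}c0 : \forall x \near F, c_ x <= e by exact: (cvgr_le _ c0).
apply: ge_ereal_inf; exists (ereal_sup (f @` [set x | (f x <= a + e%:E)%E])).
  exists [set x | (f x <= a + e%:E)%E] => //.
  near=> x; apply: (@le_trans _ _ (a + (c_ x)%:E)%E); first by near: x.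
  by apply: leeD2l; rewrite lee_fin; near: x.
by apply: ge_ereal_sup => _ [x /= fx <-].
Unshelve. all: by end_near. Qed.

(** * The l^q norms *)

Section lq_norm_theory.
Context {R : realType} {N : nat} (q : \bar R).
Hypothesis q1 : (1 <= q)%E.
Implicit Type t : 'rV[R]_N.

Lemma lq_normN t : lq_norm q (- t) = lq_norm q t.
Proof.
by case: q => [r| |] //=; under eq_bigr do rewrite mxE normrN.
Qed.

Lemma lq_norm_ge0 t : 0 <= lq_norm q t.
Proof.
case: q => [r| |] //=; first exact: powR_ge0.
by elim/big_ind : _ => // x y x0 y0; rewrite le_max x0.
Qed.

Lemma lq_penalty_ge0 t : 0 <= lq_penalty q t.
Proof.
move: q1 (lq_norm_ge0 t); case: q => [r| |]; rewrite /lq_penalty // => r1 _.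
rewrite lee_fin in r1.
by rewrite mulr_ge0 ?powR_ge0 ?invr_ge0//; lra.
Qed.

Lemma ler_lq_norm_coord t i : `|t 0 i| <= lq_norm q t.
Proof.
move: q1; case: q => [r| |] //= r1; last first.
  exact: (le_bigmax _ (fun j => `|t 0 j|)).
rewrite lee_fin in r1.
have r0 : r != 0 by lra.
(* The modulus becomes the [r]-th root of its [r]-th power, which is one term of the nonnegative
   sum. *)
rewrite -[leLHS]powRr1// -[X in _ `^ X](mulfV r0) powRrM.
apply: ge0_ler_powR; rewrite ?nnegrE ?invr_ge0 ?powR_ge0//; first by lra.
  by apply: sumr_ge0 => j _; exact: powR_ge0.
rewrite (bigD1 i)//= lerDl; apply: sumr_ge0 => j _; exact: powR_ge0.
Qed.

(** The norm of a row vector is the max norm, so convergence in [lq_norm] implies convergence in the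
    topology of the space. *)
Lemma ler_norm_lq_norm t : `|t| <= lq_norm q t.
Proof.
rewrite [`|t|]mx_normrE; apply: bigmax_le; first exact: lq_norm_ge0.
by move=> [i j] _ /=; rewrite ord1; exact: ler_lq_norm_coord.
Qed.

Lemma lq_penalty_gt0 (a : R) : 0 < a ->
  exists2 c, 0 < c & forall t, a <= lq_norm q t -> c <= lq_penalty q t.
Proof.
move=> a0; move: q1; case: q => [r| |] // r1; last by exists a.
rewrite lee_fin in r1; have r0 : 0 < r by lra.
exists (r^-1 * a `^ r); first by rewrite mulr_gt0 ?invr_gt0 ?powR_gt0.
move=> t at_; rewrite ler_pM2l ?invr_gt0//.
by apply: ge0_ler_powR; rewrite ?nnegrE ?(ltW r0) ?(ltW a0)// powR_ge0.
Qed.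

End lq_norm_theory.

(** * Weak convergence in products *)

(** A continuous functional on [Y] composed with [A] is a continuous functional on [X]. *)
Lemma weak_cvg_comp (R : realType) (X Y : normedModType R)
    (A : {linear X -> Y}) (x_ : R -> X) (x : X) :
  continuous A -> weak_cvg x_ x -> weak_cvg (fun e => A (x_ e)) (A x).
Proof.
move=> cA xx phi cphi; apply: (xx (phi \o A)) => y.
by apply: continuous_comp; [exact: cA|exact: cphi].
Qed.

Lemma weak_cvg_fst (R : realType) (X Y : normedModType R)
    (x_ : R -> X * Y) (x : X * Y) :
  weak_cvg x_ x -> weak_cvg (fun e => (x_ e).1) x.1.
Proof.
have lin : linear (@fst X Y) by [].
pose A : {linear (X * Y)%type -> X} :=
  HB.pack (@fst X Y) (GRing.isLinear.Build _ _ _ _ _ lin).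
by apply: (@weak_cvg_comp _ _ _ A) => y; exact: cvg_fst.
Qed.

Lemma weak_cvg_snd (R : realType) (X Y : normedModType R)
    (x_ : R -> X * Y) (x : X * Y) :
  weak_cvg x_ x -> weak_cvg (fun e => (x_ e).2) x.2.
Proof.
have lin : linear (@snd X Y) by [].
pose A : {linear (X * Y)%type -> Y} :=
  HB.pack (@snd X Y) (GRing.isLinear.Build _ _ _ _ _ lin).
by apply: (@weak_cvg_comp _ _ _ A) => y; exact: cvg_snd.
Qed.

Lemma weak_cvg_coord (R : realType) (N : nat) (t_ : R -> 'rV[R]_N.+1)
    (t : 'rV[R]_N.+1) (i : 'I_N.+1) :
  weak_cvg t_ t -> t_ e 0 i @[e --> 0^'+] --> t 0 i.
Proof.
pose c (M : 'rV[R]_N.+1) : R^o := M 0 i.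
have lin : linear c by move=> a u v; rewrite /c !mxE.
pose phi : {linear 'rV[R]_N.+1 -> R^o} :=
  HB.pack c (GRing.isLinear.Build _ _ _ _ _ lin).
by move=> /(_ phi); apply; exact: coord_continuous.
Qed.

(** * Values of the functionals on and off their constraint sets *)

Lemma dual_adde0 (R : realType) (x : \bar R) : dual_adde x 0%E = x.
Proof. exact: (@DualAddTheoryNumDomain.dadde0 R). Qed.

Lemma dual_addey (R : realType) (x : \bar R) : dual_adde x +oo%E = +oo%E.
Proof. exact: (@DualAddTheoryNumDomain.daddey R). Qed.

Section penalized_scenarios.
Context {R : realType} {U Z : completeNormedModType R} {d n : nat}.
Variables (xi : 'I_n.+1 -> 'rV[R]_d) (f0 : Z -> \bar R).
Variables (s : scenario_space xi -> Z -> U) (g : U -> \bar R).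
Variables (q : \bar R) (p_ : R -> 'rV[R]_n.+1) (theta : R -> R).

Lemma Phi0 (p : 'rV[R]_n.+1) (z : Z) : Phi f0 s g p (z, 0) =
  (f0 z + \sum_(i < n.+1) (p 0 i)%:E * g (s (scenario xi i) z))%E.
Proof.
rewrite /Phi /set_indicator mem_set// dual_adde0.
by under eq_bigr do rewrite mxE addr0.
Qed.

Lemma Phi_neq0 (p : 'rV[R]_n.+1) (z : Z) (t : 'rV[R]_n.+1) :
  t != 0 -> Phi f0 s g p (z, t) = +oo%E.
Proof.
move=> /eqP t0; rewrite /Phi /set_indicator memNset//.
exact: dual_addey.
Qed.

Lemma Phi_eps_simplex (e : R) (z : Z) (t : 'rV[R]_n.+1) :
  prob_simplex (p_ e + t) ->
  Phi_eps f0 s g q p_ theta e (z, t) =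
  (f0 z + \sum_(i < n.+1) ((p_ e + t) 0 i)%:E * g (s (scenario xi i) z)
   + (theta e * lq_penalty q t)%:E)%E.
Proof.
move=> pt; rewrite /Phi_eps /set_indicator mem_set//.
rewrite dual_adde0.
by under [in RHS]eq_bigr do rewrite mxE.
Qed.

(** Off the simplex the value is [+oo] and every bound holds, so only the parameters with admissible
    weights have to be examined. *)
Lemma ev_lbound_Phi_eps (F : set_system R) {FF : Filter F} (z_ : R -> Z)
    (t_ : R -> 'rV[R]_n.+1) (a : \bar R) :
  ev_lbound (within [set e | prob_simplex (p_ e + t_ e)] F)
    (fun e => f0 (z_ e)
      + \sum_(i < n.+1) ((p_ e + t_ e) 0 i)%:E * g (s (scenario xi i) (z_ e))
      + (theta e * lq_penalty q (t_ e))%:E)%E a ->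
  ev_lbound F (fun e => Phi_eps f0 s g q p_ theta e (z_ e, t_ e)) a.
Proof.
move=> H M /H; rewrite near_withinE; apply: filterS => e He.
have [pt|npt] := pselect (prob_simplex (p_ e + t_ e)).
  by rewrite Phi_eps_simplex//; exact: He.
rewrite /Phi_eps /set_indicator memNset//.
by rewrite dual_addey leey.
Qed.

End penalized_scenarios.

(** * Averages over the simplex and atoms of the scenario space *)

Lemma simplex_sum_ge (R : realType) (N : nat) (q : 'rV[R]_N)
    (h : 'I_N -> \bar R) (gamma : R) :
  prob_simplex q -> (forall i, (gamma%:E <= h i)%E) ->
  (gamma%:E <= \sum_(i < N) (q 0 i)%:E * h i)%E.
Proof.
move=> [q1 q0] hgamma.
apply: (@le_trans _ _ (\sum_(i < N) (q 0 i)%:E * gamma%:E)%E).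
  under eq_bigr do rewrite -EFinM.
  by rewrite sumEFin -mulr_suml q1 mul1r.
apply: lee_sum => i _; apply: lee_wpmul2l => //.
by rewrite lee_fin; case/andP: (q0 i).
Qed.

(** A singleton of nonzero mass cannot lie in a negligible set. *)
Lemma ae_scenario (R : realType) (d n : nat) (xi : 'I_n.+1 -> 'rV[R]_d)
    (P : probability (scenario_space xi) R) (Q : scenario_space xi -> Prop)
    (i : 'I_n.+1) :
  P [set scenario xi i] != 0 -> {ae P, forall x, Q x} -> Q (scenario xi i).
Proof.
move=> Pi0 aeQ; apply: contrapT => nQ; move/eqP : Pi0; apply.
have := @negligibleP _ _ _ P [set scenario xi i] I; case=> + _; apply.
by apply: negligibleS aeQ => x /= ->.
Qed.

(** * Mosco convergence: recovery families and lower bound *)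

Theorem theorem3p4 (R : realType) (U Z : completeNormedModType R)
    (d n : nat) (xi : 'I_n.+1 -> 'rV[R]_d)
    (p : 'rV[R]_n.+1) (hp : prob_simplex p)
    (P : probability (scenario_space xi) R)
    (hP : forall i : 'I_n.+1, P [set scenario xi i] = (p 0 i)%:E)
    (f0 : Z -> \bar R) (s : scenario_space xi -> Z -> U) (g : U -> \bar R)
    (hS : assumption_S P s) (hFG : assumption_FG f0 g)
    (q : \bar R) (hq : (1 <= q)%E)
    (p_ : R -> 'rV[R]_n.+1)
    (hp_ : forall e : R, 0 < e -> prob_simplex (p_ e))
    (hp_cvg : lq_norm q (p_ e - p) @[e --> 0^'+] --> (0 : R))
    (theta : R -> R)
    (htheta : forall e : R, 0 < e -> 0 < theta e)
    (htheta_cvg : theta e @[e --> 0^'+] --> +oo)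
    (hrate_fin : forall r : R, q = r%:E ->
      theta e * lq_norm q (p_ e - p) `^ r @[e --> 0^'+] --> (0 : R))
    (hrate_infty : q = +oo%E ->
      theta e * lq_norm q (p_ e - p) @[e --> 0^'+] --> (0 : R)) :
  Mosco_cvg (Phi_eps f0 s g q p_ theta) (Phi f0 s g p).
Proof.
have [_ hs] := hS; have [[f0Ny _] f0lsc glsc [gamma ggamma]] := hFG.
have [_ p01] := hp.
have p_p : p - p_ e @[e --> 0^'+] --> (0 : 'rV[R]_n.+1).
  apply: norm_cvg0.
  apply: (@squeeze_cvgr _ _ _ _ (cst 0) _ _ _ _ (cvg_cst _) hp_cvg).
  by apply: nearW => e /=; rewrite normr_ge0 -lq_normN opprB ler_norm_lq_norm.
split=> [[z t]|x_ [z t] xx].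
  have [->|t0] := eqVneq t 0; last first.
    by exists (fun=> (z, t)); split; [exact: cvg_cst|rewrite Phi_neq0// leey].
  exists (fun e => (z, p - p_ e)); split.
    exact: (cvg_pair (G := nbhs z) (f := fun=> z) (cvg_cst _) p_p).
  (* Since [p_ e + (p - p_ e) = p] is in the simplex, [Phi_eps] equals [Phi] at [(z, 0)] plus the
     penalty. *)
  apply: (@limf_esup_le_cvg _ _ _ _ _
    (fun e => theta e * lq_penalty q (p - p_ e))).
    apply: nearW => e; have pe : p_ e + (p - p_ e) = p by rewrite addrC subrK.
    by rewrite Phi_eps_simplex pe// Phi0.
  under eq_fun do rewrite -opprB.
  case: q hq hrate_fin hrate_infty {hp_cvg p_p} => [r| |] // _ hfin hinfty.
    have : r^-1 * (theta e * lq_norm r%:E (p_ e - p) `^ r) @[e --> 0^'+]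
        --> r^-1 * 0 by apply: cvgM; [exact: cvg_cst|exact: hfin].
    rewrite mulr0.
    apply: cvg_trans; apply: near_eq_cvg; apply: nearW => e.
    by rewrite /lq_penalty lq_normN mulrCA.
  by under eq_fun do rewrite /lq_penalty lq_normN; exact: hinfty.
have zz : weak_cvg (fun e => (x_ e).1) z by exact: (weak_cvg_fst _ _ _ _ _ xx).
have tt i : (x_ e).2 0 i @[e --> 0^'+] --> t 0 i.
  by apply: weak_cvg_coord; exact: (weak_cvg_snd _ _ _ _ _ xx).
apply/le_limf_einfP.
rewrite [X in ev_lbound _ X _](_ : _ =
    fun e => Phi_eps f0 s g q p_ theta e ((x_ e).1, (x_ e).2)); last first.
  by apply/funext => e; case: (x_ e).
apply: ev_lbound_Phi_eps.
set D := within _ _.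
have f0D : ev_lbound D (fun e => f0 (x_ e).1) (f0 z).
  by apply: ev_lbound_within; apply/le_limf_einfP; exact: f0lsc.
have simplexD : \forall e \near D, prob_simplex (p_ e + (x_ e).2).
  exact: near_withinT.
have [t0|t0] := eqVneq t 0; last first.
  have [i ti] : exists i, t 0 i != 0.
    by have [j] := rV0Pn _ t0; exists j.
  have ti2 : 0 < `|t 0 i| / 2 by rewrite divr_gt0 ?normr_gt0.
  have [c c0 hc] := @lq_penalty_gt0 _ n.+1 _ hq _ ti2.
  (* The target [+oo] is split to match the three summands: [f0 z] for the first, [gamma] for the
     weighted sum, [+oo] for the penalty. *)
  rewrite Phi_neq0// -(@addey _ (f0 z + gamma%:E)%E); last first.
    by case: (f0 z) (f0Ny z).
  apply: ev_lboundD => //.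
  - by apply: gtNyD => //; exact: ltNyr.
  - apply: ev_lboundD => //; first exact: ltNyr.
    apply: ev_lbound_le (ev_lbound_cst _ _).
    by apply: filterS simplexD => e /simplex_sum_ge; apply.
  (* Eventually the [i]-th coordinate has modulus at least half its limit, so the penalty factor is
     at least [c]; once [theta e] reaches [|M| / c], the product is at least [|M|]. *)
  - move=> M _; apply: cvg_within.
    have H : \forall e \near 0^'+, `|M| / c <= theta e.
      by move/cvgryPge : htheta_cvg; exact.
    have H' : \forall e \near 0^'+, `|t 0 i| / 2 <= `|(x_ e).2 0 i|.
      apply: (cvgr_ge `|t 0 i|); first by apply: cvg_norm; exact: tt.
      by rewrite ltr_pdivrMr// mulr_natr mulr2n ltrDl normr_gt0.
    near=> e; rewrite lee_fin; apply: le_trans (ler_norm _) _.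
    rewrite -[leLHS](divfK (lt0r_neq0 c0)); apply: ler_pM.
    + by rewrite divr_ge0// ltW.
    + exact: ltW.
    + by near: e.
    + apply: hc; apply: le_trans (ler_lq_norm_coord _ hq _ i) => //.
      by near: e.
rewrite {}t0 in xx tt *; rewrite Phi0 -[X in ev_lbound _ _ X]adde0.
have gNy i : (-oo < (p 0 i)%:E * g (s (scenario xi i) z))%E.
  apply: (@lt_le_trans _ _ ((p 0 i)%:E * gamma%:E)%E).
    by rewrite -EFinM ltNyr.
  by apply: lee_wpmul2l => //; rewrite lee_fin; case/andP : (p01 i).
have sNy : (-oo < \sum_(i < n.+1) (p 0 i)%:E * g (s (scenario xi i) z))%E.
  exact: gtNy_sum.
apply: ev_lboundD.
- exact: gtNyD.
- exact: ltNyr.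
- apply: ev_lboundD => //; apply: ev_lbound_sum => // i.
  apply: (@ev_lboundM _ _ _ _ _ _ gamma) => //.
  + by case/andP : (p01 i).
  + by apply: filterS simplexD => e -[_ /(_ i)/andP[]].
  + apply: cvg_within_filter.
    have ppi : (p - p_ e) 0 i @[e --> 0^'+] --> (0 : 'rV[R]_n.+1) 0 i.
      exact: (continuous_cvg _ (@coord_continuous _ _ _ 0 i _) p_p).
    (* This form of the weight [(p_ e + (x_ e).2) 0 i] involves only terms with known limits. *)
    have : p 0 i - (p - p_ e) 0 i + (x_ e).2 0 i @[e --> 0^'+]
        --> p 0 i - (0 : 'rV[R]_n.+1) 0 i + (0 : 'rV[R]_n.+1) 0 i.
      by apply: cvgD => //; apply: cvgB => //; exact: cvg_cst.
    rewrite !mxE subr0 addr0; apply: cvg_trans; apply: near_eq_cvg.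
    by apply: nearW => e /=; rewrite !mxE; ring.
  + move=> pi0; apply: ev_lbound_within; apply/le_limf_einfP; apply: glsc.
    by apply: ae_scenario (hs _ _ zz); rewrite hP eqe gt_eqF.
- apply: ev_lbound_within; apply: ev_lbound_le (ev_lbound_cst _ _).
  by near=> e; rewrite lee_fin mulr_ge0 ?lq_penalty_ge0// ltW// htheta.
Unshelve. all: by end_near. Qed.
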